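(* Let $K$ be a field and let $\alpha,\beta,\gamma,t$ be integers with $1\le\alpha\le\beta$, $\gamma=2(\alpha+\beta)$, and $t\ge\frac13(\alpha+\beta+\gamma)=\alpha+\beta$. Consider the ideal $$I=(x^{\alpha+t},y^{\beta+t},z^{\gamma+t},x^\alpha y^\beta z^\gamma)\subset R=K[x,y,z].$$ Then $R/I$ has the weak Lefschetz property if $\operatorname{char}K=0$ or $\operatorname{char}K\ge t+\alpha+\beta$.
   Context: $R=K[x,y,z]$ carries the standard grading. A standard graded Artinian $K$-algebra $A$ has the weak Lefschetz property if there is a linear form $\ell\in [A]_1$ such that, for all integers $d$, the multiplication map $\times\ell:[A]_d\to[A]_{d+1}$ has maximal rank, that is, it is injective or surjective. *)

(* Defs.v *)
From HB Require Import structures.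
From mathcomp Require Import all_boot all_order all_algebra.
From mathcomp Require Import generic_quotient ring_quotient boolp mpoly.

Set Implicit Arguments.
Unset Strict Implicit.
Unset Printing Implicit Defensive.

Import GRing.Theory.
Local Open Scope ring_scope.
Local Open Scope quotient_scope.

Section QuotientByGenerators.
Variables (R : comNzRingType) (gs : seq R).

Definition in_ideal (f : R) : Prop :=
  exists c : nat -> R, f = \sum_(i < size gs) c i * gs`_i.

Lemma in_ideal0 : in_ideal 0.
Proof. by exists (fun=> 0); rewrite big1 // => i _; rewrite mul0r. Qed.

Lemma in_idealB f g : in_ideal f -> in_ideal g -> in_ideal (f - g).
Proof.
case=> [c ->] [d ->]; exists (fun i => c i - d i).
by rewrite -sumrB; apply: eq_bigr => i _; rewrite mulrBl.
Qed.

Lemma in_idealM h f : in_ideal f -> in_ideal (h * f).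
Proof.
case=> [c ->]; exists (fun i => h * c i).
by rewrite mulr_sumr; apply: eq_bigr => i _; rewrite mulrA.
Qed.

Definition ideal_pred (f : R) : bool := `[< in_ideal f >].

Fact ideal_pred_zmod_closed : zmod_closed ideal_pred.
Proof.
split=> [|f g /asboolP fI /asboolP gI]; apply/asboolP; first exact: in_ideal0.
exact: in_idealB.
Qed.

HB.instance Definition _ :=
  GRing.isZmodClosed.Build R ideal_pred ideal_pred_zmod_closed.

Definition ideal_zmod : zmodClosed R :=
  GRing.ZmodClosed.clone R ideal_pred _.

(* [idealr] and the library's ring structure on [{ideal_quot _}] require the  *)
(* ideal to be proper. No such condition is imposed here, so the quotient is  *)
(* only a [comPzRingType] (the zero ring when the ideal is the unit ideal).   *)
Definition quot_by : Type := {ideal_quot ideal_zmod}.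

HB.instance Definition _ := GRing.Zmodule.on quot_by.

Definition quot_map (f : R) : quot_by := \pi_{ideal_quot ideal_zmod} f.

Lemma quot_map_eq f g : quot_map f = quot_map g <-> in_ideal (f - g).
Proof.
split=> [/eqP|fgI]; first by rewrite -Quotient.idealrBE => /asboolP.
by apply/eqP; rewrite -Quotient.idealrBE; apply/asboolP.
Qed.

Lemma quot_map_surj (a : quot_by) : exists f, quot_map f = a.
Proof. by exists (repr a); exact: reprK. Qed.

Fact quot_map_zmod : zmod_morphism quot_map.
Proof. by move=> f g; exact: (pi_is_zmod_morphism {ideal_quot ideal_zmod}). Qed.

HB.instance Definition _ :=
  GRing.isZmodMorphism.Build R quot_by quot_map quot_map_zmod.

Definition quot_one : quot_by := quot_map 1.
Definition quot_mul (a b : quot_by) : quot_by := quot_map (repr a * repr b).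

Fact quot_map_mul : {morph quot_map : f g / f * g >-> quot_mul f g}.
Proof.
move=> f g; apply/quot_map_eq.
set f' := repr _; set g' := repr _.
have fI : in_ideal (f - f') by apply/quot_map_eq; rewrite /quot_map reprK.
have gI : in_ideal (g - g') by apply/quot_map_eq; rewrite /quot_map reprK.
have -> : f * g - f' * g' = g * (f - f') - - f' * (g - g').
  by rewrite mulNr opprK !mulrBr [g * f]mulrC [g * f']mulrC addrA subrK.
by apply: in_idealB; apply: in_idealM.
Qed.

Fact quot_mulA : associative quot_mul.
Proof.
move=> a b c; have [[[f <-] [g <-]] [h <-]] :=
  (quot_map_surj a, quot_map_surj b, quot_map_surj c).
by rewrite -!quot_map_mul mulrA.
Qed.

Fact quot_mulC : commutative quot_mul.
Proof. by move=> a b; rewrite /quot_mul mulrC. Qed.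

Fact quot_mul1 : left_id quot_one quot_mul.
Proof.
by move=> a; have [f <-] := quot_map_surj a; rewrite -quot_map_mul mul1r.
Qed.

Fact quot_mulDl : left_distributive quot_mul +%R.
Proof.
move=> a b c; have [[[f <-] [g <-]] [h <-]] :=
  (quot_map_surj a, quot_map_surj b, quot_map_surj c).
by rewrite -raddfD -!quot_map_mul mulrDl raddfD.
Qed.

HB.instance Definition _ := GRing.Zmodule_isComPzRing.Build quot_by
  quot_mulA quot_mulC quot_mul1 quot_mulDl.

Fact quot_map_monoid : monoid_morphism quot_map.
Proof. by split=> //; exact: quot_map_mul. Qed.

HB.instance Definition _ :=
  GRing.isMonoidMorphism.Build R quot_by quot_map quot_map_monoid.

End QuotientByGenerators.

(* [R/I]_d, the image of [R]_d in R/I. *)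
Definition quot_piece (K : fieldType) (n : nat) (gs : seq {mpoly K[n]})
    (d : nat) (a : quot_by gs) : Prop :=
  exists2 f : {mpoly K[n]}, f \is d.-homog & a = quot_map gs f.
Arguments quot_piece {K n} gs d a.

(* [gr d] is the graded piece [A]_d. Pieces of negative degree are zero, so   *)
(* the condition in degrees d < 0 holds trivially (by injectivity).           *)
Definition weak_lefschetz (A : pzRingType) (gr : nat -> A -> Prop) : Prop :=
  exists2 l : A, gr 1%N l &
    forall d : nat,
      (forall a b : A, gr d a -> gr d b -> l * a = l * b -> a = b) \/
      (forall c : A, gr d.+1 c -> exists2 a : A, gr d a & l * a = c).

(* Main.v *)
(* Take l = x + y + z and put s = alpha + beta, t = s + n. In R/(l), with     *)
(* z = -(x + y) and y = 1, the degree d0 = 3s + n - 1 part of I consists of   *)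
(* the polynomials                                                            *)
(*   x^(alpha+t) A + B + x^alpha (x+1)^(2s) C                                 *)
(* with deg A < alpha + 2beta, deg B < 2alpha + beta, deg C < n (the          *)
(* generator z^(2s+t) has degree d0 + 1). These bounds add up to 3s + n,      *)
(* which is the dimension of K[x, y] in degree d0, so it suffices that this   *)
(* expression vanishes only for A = B = C = 0. Cancelling x^alpha turns this  *)
(* into: if (x+1)^(2s) C = x^(n+s) A + B with deg B < s, then C = 0. The s-th *)
(* derivative kills B, hence is divisible by x^n (x+1)^s; its degree being    *)
(* less than n + s it is 0, and as the characteristic is at least 2s + n the  *)
(* left-hand side then has degree less than s, which forces C = 0.            *)
(* Injectivity of the system gives injectivity of l into every degree up to   *)
(* d0 (a relation l f = sum c_i g_i has all relevant c_i divisible by l), and *)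
(* its surjectivity gives surjectivity of l onto degree d0 and hence beyond.  *)
Require Import Defs.
From HB Require Import structures.
From mathcomp Require Import all_boot all_order all_algebra.
From mathcomp Require Import mpoly.
From mathcomp Require Import zify ring.

Import GRing.Theory.
Local Open Scope ring_scope.

(** Everything reduces to one square linear system in one variable. Its core is a gap statement,
    [XD1_expM_gap_eq0]: a nonzero multiple of (X+1)^(2s) of degree less than 2s + n cannot have all
    its coefficients in degrees s, ..., s+n-1 equal to zero. This yields [square_system_inj], and
    counting dimensions turns it into [square_system_surj]. By [dhomog_mod_linform], forms of degree
    e modulo l are univariate polynomials of degree at most e, so the two statements lift to
    [aci_inj] (l into degrees up to d0) and [aci_surj] (l onto degrees from d0 on), which together
    cover all degrees. *)

(** * Derivatives and the gap statement *)

Lemma dvdp_exp_derivn (K : fieldType) (q P : {poly K}) (m s : nat) :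
  q ^+ (m + s) %| P -> q ^+ m %| P^`(s).
Proof.
elim: s m => [|s IHs] m; first by rewrite addn0.
rewrite addnS -addSn => /IHs /dvdpP[r rE].
rewrite derivnS rE derivM deriv_exp /= exprS.
by rewrite -mulr_natl dvdp_add ?dvdp_mull ?dvdp_mulr.
Qed.

Lemma size_derivn_leq (K : fieldType) (P : {poly K}) (s n : nat) :
  (size P <= n + s)%N -> (size P^`(s) <= n)%N.
Proof.
move=> szP; apply/leq_sizeP => i le_ni; rewrite coef_derivn.
by rewrite nth_default ?mul0rn // (leq_trans szP) // addnC leq_add2l.
Qed.

Lemma natr_ffact_neq0 (K : fieldType) (N i s : nat) :
    (forall k, (0 < k < N)%N -> k%:R != 0 :> K) ->
  (s <= i < N)%N -> (i ^_ s)%:R != 0 :> K.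
Proof.
move=> natN; elim: s i => [|s IHs] i; first by rewrite ffactn0 oner_eq0.
case: i => // i /andP[le_si lt_iN].
rewrite ffactSS natrM mulf_neq0 //; first by rewrite natN.
by rewrite IHs // (ltnW lt_iN) andbT.
Qed.

(** This is where the characteristic enters: below degree N the falling factorials produced by
    differentiation are invertible, whereas in characteristic p a derivative also kills X^p. *)
Lemma size_leq_derivn_eq0 (K : fieldType) (N : nat) (P : {poly K}) (s : nat) :
    (forall k, (0 < k < N)%N -> k%:R != 0 :> K) ->
  (size P <= N)%N -> P^`(s) = 0 -> (size P <= s)%N.
Proof.
move=> natN szP P0; apply/leq_sizeP => i le_si.
have [/(leq_trans szP) szi|lt_iN] := leqP N i; first exact: nth_default.
have /(congr1 (fun p : {poly K} => p`_(i - s))) := P0.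
rewrite coef_derivn coef0 subnKC // -mulr_natr => /eqP; rewrite mulf_eq0.
by rewrite (negPf (natr_ffact_neq0 _ _ _ _ natN _)) ?le_si // orbF => /eqP.
Qed.

Lemma coprimep_XD1 (K : fieldType) : coprimep ('X : {poly K}) ('X + 1).
Proof.
rewrite coprimep_sym; have := coprimep_XsubC ('X + 1 : {poly K}) 0.
by rewrite subr0 => ->; rewrite /root !hornerE oner_eq0.
Qed.

Lemma XD1_expM_gap_eq0 (K : fieldType) (s n : nat) (A B C : {poly K}) :
    (forall k, (0 < k < s.*2 + n)%N -> k%:R != 0 :> K) ->
    (size B <= s)%N -> (size C <= n)%N ->
  ('X + 1) ^+ s.*2 * C = 'X^(n + s) * A + B -> C = 0.
Proof.
move=> natN szB szC; set P := _ * C => defP.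
have sz1 k : size (('X + 1 : {poly K}) ^+ k) = k.+1.
  by have := size_exp_XsubC k (-1 : K); rewrite polyCN opprK.
have [->//|C0] := eqVneq C 0.
have q0 k : ('X + 1 : {poly K}) ^+ k != 0 by rewrite -size_poly_eq0 sz1.
have szP : (size P <= s.*2 + n)%N.
  by rewrite /P size_mul // sz1 leq_add2l.
(* A nonzero derivative would be a multiple of X^n (X+1)^s, of size n + s + 1, against the bound n +
   s. *)
have dP0 : P^`(s) = 0.
  apply/eqP; apply: contraTT isT => dP.
  have /(dvdp_leq dP) : 'X^n * ('X + 1) ^+ s %| P^`(s).
    rewrite Gauss_dvdp; last exact/coprimep_expl/coprimep_expr/coprimep_XD1.
    apply/andP; split; last by apply: dvdp_exp_derivn; rewrite addnn dvdp_mulIl.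
    rewrite defP derivnD (derivn_poly0 szB) addr0.
    by apply: dvdp_exp_derivn; rewrite dvdp_mulIl.
  have szdP : (size P^`(s) <= n + s)%N by apply: size_derivn_leq; lia.
  rewrite size_mul ?q0 ?monic_neq0 ?monicXn // size_polyXn sz1.
  by move=> /leq_trans/(_ szdP); rewrite addSn addnS ltnn.
have szPs := size_leq_derivn_eq0 _ _ _ _ natN szP dP0.
have P0 : P != 0 by rewrite mulf_neq0.
have /(dvdp_leq P0) : ('X + 1) ^+ s.*2 %| P by exact: dvdp_mulIl.
by rewrite sz1 => /leq_trans/(_ szPs) lt_ss; exfalso; lia.
Qed.

(** * The square system *)

(* [- ('X + 1)] is the image of z in K[x, y, z] / (x + y + z, y - 1). *)
Definition zpoly (K : fieldType) : {poly K} := - ('X + 1).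

(** The summands are the images of multiples of x^(a+t), y^(b+t) and x^a y^b z^(2s), where s = a + b
    and t = s + n. *)
Definition square_system (K : fieldType) (a b n : nat) (A B C : {poly K}) :
    {poly K} :=
  'X^(a + (a + b + n)) * A + B + 'X^a * zpoly K ^+ (2 * (a + b)) * C.

(** The summands other than B are multiples of X^a, so B is one too and X^a cancels. The gap
    statement then kills C, and degrees separate A from B. *)
Lemma square_system_inj (K : fieldType) (a b n : nat) (A B C : {poly K}) :
    (forall k, (0 < k < (a + b).*2 + n)%N -> k%:R != 0 :> K) ->
    (size A <= a + b.*2)%N -> (size B <= a.*2 + b)%N -> (size C <= n)%N ->
    square_system K a b n A B C = 0 ->
  [/\ A = 0, B = 0 & C = 0].
Proof.
rewrite /square_system => natN szA szB szC sys0.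
(* The exponent is even, so the sign of the image of z disappears. *)
have wE : zpoly K ^+ (2 * (a + b)) = ('X + 1) ^+ (a + b).*2.
  by rewrite mul2n /zpoly exprNn -signr_odd odd_double mul1r.
have {wE} sys0 : B = 'X^a * (- ('X^(n + (a + b)) * A + ('X + 1) ^+ (a + b).*2 * C)).
  move: sys0; rewrite wE => /eqP; rewrite addrAC addrC addr_eq0 => /eqP ->.
  by rewrite exprD [(n + _)%N]addnC; ring.
set B1 := - _ in sys0.
have szB1 : (size B1 <= a + b)%N.
  have [->|B1_0] := eqVneq B1 0; first by rewrite size_poly0.
  by move: szB; rewrite sys0 mulrC size_mulXn // -addnn -addnA leq_add2l.
have C0 : C = 0.
  apply: (@XD1_expM_gap_eq0 K (a + b) n (- A) (- B1)) => //.
  - by rewrite size_polyN.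
  - by rewrite /B1; ring.
move: sys0; rewrite {}/B1 in szB1 *; rewrite C0 mulr0 addr0 => BE.
rewrite C0 mulr0 addr0 size_polyN in szB1.
have A0 : A = 0.
  apply/eqP; apply: contraTT szB1; rewrite -size_poly_gt0 => A_gt0.
  rewrite mulrC size_mulXn -?size_poly_gt0 // -ltnNge addnAC.
  by rewrite -[X in (X < _)%N]add0n ltn_add2r addn_gt0 A_gt0 orbT. 
by rewrite BE A0 mulr0 oppr0 mulr0.
Qed.

Lemma linear_inj_surj (K : fieldType) (m : nat)
    (f : {linear 'rV[K]_m -> 'rV[K]_m}) :
  (forall v, f v = 0 -> v = 0) -> forall u, exists v, f v = u.
Proof.
move=> finj u; have : row_free (lin1_mx f).
  by apply: inj_row_free => v; rewrite mul_rV_lin1 => /finj.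
rewrite row_free_unit => fU; exists (u *m invmx (lin1_mx f)).
by rewrite -mul_rV_lin1 mulmxKV.
Qed.

(** The blocks hold the coefficients of A, B and C; their total length 3s + n is also the number of
    coefficients of the value, which makes the system an endomorphism. *)
Definition square_row (K : fieldType) (a b n : nat)
    (v : 'rV[K]_(a + b.*2 + (a.*2 + b + n))) :
    'rV[K]_(a + b.*2 + (a.*2 + b + n)) :=
  poly_rV (square_system K a b n (rVpoly (lsubmx v))
             (rVpoly (lsubmx (rsubmx v))) (rVpoly (rsubmx (rsubmx v)))).

Fact square_row_is_linear (K : fieldType) (a b n : nat) :
  linear (square_row K a b n).
Proof.
move=> c u v; rewrite /square_row -linearP; congr poly_rV.
rewrite /square_system !linearP /= -!mul_polyC; ring.
Qed.

HB.instance Definition _ (K : fieldType) (a b n : nat) :=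
  GRing.isLinear.Build K _ _ _ (square_row K a b n)
    (square_row_is_linear K a b n).

Lemma size_square_system (K : fieldType) (a b n : nat) (A B C : {poly K}) :
    (size A <= a + b.*2)%N -> (size B <= a.*2 + b)%N -> (size C <= n)%N ->
  (size (square_system K a b n A B C) <= a + b.*2 + (a.*2 + b + n))%N.
Proof.
move=> szA szB szC.
have szM (p q : {poly K}) k l : (size p <= k.+1)%N -> (size q <= l)%N ->
    (size (p * q)%R <= k + l)%N.
  move=> szp szq; apply: leq_trans (size_polyMleq p q) _.
  by rewrite -subn1 leq_subLR add1n -addSn leq_add.
have szw : (size (zpoly K ^+ (2 * (a + b))) <= (2 * (a + b)).+1)%N.
  apply: leq_trans (size_poly_exp_leq _ _) _.
  by rewrite size_polyN size_XaddC mul1n.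
have szX k : (size ('X^k : {poly K}) <= k.+1)%N by rewrite size_polyXn.
rewrite /square_system -mulrA.
have szXA := szM _ _ _ _ (szX (a + (a + b + n))%N) szA.
have szXC := szM _ _ _ _ (szX a) (szM _ _ _ _ szw szC).
rewrite (leq_trans (size_polyD _ _)) // geq_max; apply/andP; split; last first.
  by apply: leq_trans szXC _; lia.
rewrite (leq_trans (size_polyD _ _)) // geq_max; apply/andP; split.
  by apply: leq_trans szXA _; lia.
by apply: leq_trans szB _; lia.
Qed.

Lemma square_system_surj (K : fieldType) (a b n : nat) (F : {poly K}) :
    (forall k, (0 < k < (a + b).*2 + n)%N -> k%:R != 0 :> K) ->
    (size F <= (a + b) * 3 + n)%N ->
  exists A B C : {poly K},
    [/\ (size A <= a + b.*2)%N, (size B <= a.*2 + b)%N, (size C <= n)%N &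
        F = square_system K a b n A B C].
Proof.
move=> natN szF.
have [v fv0|v fvE] := linear_inj_surj K _ (square_row K a b n) _ (poly_rV F).
  have := congr1 rVpoly fv0.
  rewrite poly_rV_K ?size_square_system ?size_poly // linear0.
  case/square_system_inj => //; rewrite ?size_poly // => A0 B0 C0.
  rewrite -[v]hsubmxK -[rsubmx v]hsubmxK.
  rewrite -[lsubmx v]rVpolyK A0 -[lsubmx _]rVpolyK B0 -[rsubmx _]rVpolyK C0.
  by rewrite !linear0 !row_mx0.
have := congr1 rVpoly fvE; rewrite !poly_rV_K ?size_square_system ?size_poly //.
  by move=> <-; do 3!eexists; split; last reflexivity; exact: size_poly.
by apply: leq_trans szF _; lia.
Qed.

(** * Forms modulo l as univariate polynomials *)

Local Notation "''x'" := ('X_(@Ordinal 3 0 isT)) (at level 0, only parsing).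
Local Notation "''y'" := ('X_(@Ordinal 3 1 isT)) (at level 0, only parsing).
Local Notation "''z'" := ('X_(@Ordinal 3 2 isT)) (at level 0, only parsing).

Definition linform (K : fieldType) : {mpoly K[3]} := 'x + 'y + 'z.

Definition dehom (K : fieldType) : {mpoly K[3]} -> {poly K} :=
  mmap (@polyC K) (fun i : 'I_3 => [:: 'X; 1; zpoly K]`_i).

HB.instance Definition _ (K : fieldType) := GRing.RMorphism.on (dehom K).

(* Homogenization to degree e in x and y; coefficients of c beyond e are      *)
(* dropped.                                                                   *)
Definition hom2 (K : fieldType) (e : nat) (c : {poly K}) : {mpoly K[3]} :=
  \sum_(j < e.+1) c`_j *: ('x ^+ j * 'y ^+ (e - j)).

Section Dehomogenization.
Variable K : fieldType.
Implicit Types (c d : {poly K}) (C F : {mpoly K[3]}).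

Lemma dehomX (i : 'I_3) : dehom K 'X_i = [:: 'X; 1; zpoly K]`_i.
Proof. by rewrite /dehom mmapX mmap1U. Qed.

Lemma dehomZ k F : dehom K (k *: F) = k *: dehom K F.
Proof. by rewrite /dehom mmapZ mul_polyC. Qed.

Lemma dehom_linform : dehom K (linform K) = 0.
Proof. by rewrite /linform !rmorphD /= !dehomX /= /zpoly addrN. Qed.

Lemma dhomogXi (i : 'I_3) : ('X_i : {mpoly K[3]}) \is 1.-homog.
Proof. by rewrite dhomogX /= mdeg1. Qed.

Lemma dhomogXiE (i : 'I_3) (k : nat) : ('X_i ^+ k : {mpoly K[3]}) \is k.-homog.
Proof. by rewrite -[k in k.-homog]mul1n dhomogMn ?dhomogXi. Qed.

Lemma dhomog_linform : linform K \is 1.-homog.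
Proof. by rewrite /linform !rpredD ?dhomogXi. Qed.

Lemma linform_neq0 : linform K != 0.
Proof.
apply/eqP => /(congr1 (mcoeff U_(@Ordinal 3 0 isT))).
by rewrite /linform !mcoeffD !mcoeffXU mcoeff0 /= !addr0 => /eqP; rewrite oner_eq0.
Qed.

Lemma hom2P k e c d : hom2 K e (k *: c + d) = k *: hom2 K e c + hom2 K e d.
Proof.
rewrite /hom2 scaler_sumr -big_split; apply: eq_bigr => j _ /=.
by rewrite coefD coefZ scalerDl scalerA.
Qed.

HB.instance Definition _ e :=
  GRing.isLinear.Build K _ _ _ (hom2 K e) (fun k c d => hom2P k e c d).

Lemma hom2_Xn i j : hom2 K (i + j) 'X^i = 'x ^+ i * 'y ^+ j.
Proof.
have lt_i : (i < (i + j).+1)%N by rewrite ltnS leq_addr.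
rewrite /hom2 (bigD1 (Ordinal lt_i)) //= big1 => [|k /eqP neq_ki].
  by rewrite coefXn eqxx scale1r addr0 addKn.
by rewrite coefXn; case: eqP => [ki|_]; [case: neq_ki; exact: val_inj|rewrite scale0r].
Qed.

Lemma dhomog_hom2 e c : hom2 K e c \is e.-homog.
Proof.
apply: rpred_sum => j _; apply: rpredZ.
have := dhomogM (dhomogXiE (@Ordinal 3 0 isT) j) (dhomogXiE (@Ordinal 3 1 isT) (e - j)).
by rewrite subnKC // -ltnS.
Qed.

(** Splitting a form in x and y along the ideal (x, y) is what carries surjectivity from one degree
    to the next. *)
Lemma hom2S e c :
  hom2 K e.+1 c = 'y * hom2 K e (c`_0)%:P + 'x * hom2 K e (\poly_(j < e.+1) c`_j.+1).
Proof.
rewrite {1}/hom2 big_ord_recl; congr (_ + _).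
  have := hom2_Xn 0 e; rewrite !expr0 mul1r add0n => hom2_1.
  by rewrite -[_%:P]mulr1 mul_polyC linearZ /= hom2_1 mul1r subn0 exprS scalerAr.
rewrite mulr_sumr; apply: eq_bigr => j _.
by rewrite coef_poly ltn_ord -scalerAr mulrA -exprS.
Qed.

Lemma dehom_hom2 e c : dehom K (hom2 K e c) = \poly_(j < e.+1) c`_j.
Proof.
rewrite /hom2 rmorph_sum poly_def; apply: eq_bigr => j _ /=.
by rewrite dehomZ rmorphM !rmorphXn /= !dehomX /= expr1n mulr1.
Qed.

Lemma dehom_hom2_id m c : (size c <= m)%N -> dehom K (hom2 K m.-1 c) = c.
Proof.
move=> szc; rewrite dehom_hom2; apply/polyP => j; rewrite coef_poly.
case: ltnP => // le_mj; rewrite nth_default // (leq_trans szc) //.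
by rewrite (leq_trans (leqSpred m)).
Qed.

Lemma hom2_dehom_hom2 e c : hom2 K e (dehom K (hom2 K e c)) = hom2 K e c.
Proof.
by apply: eq_bigr => j _; rewrite dehom_hom2 coef_poly ltn_ord.
Qed.

(** Substituting z = l - x - y for one factor z lowers the exponent of z; induct on it. *)
Lemma dhomog_mod_linform_mnm i j k :
  exists2 Q : {mpoly K[3]}, Q \is ((i + j + k).-1).-homog &
    exists c, 'x ^+ i * 'y ^+ j * 'z ^+ k = linform K * Q + hom2 K (i + j + k) c.
Proof.
elim: k i j => [|k IHk] i j.
  exists 0; first exact: rpred0.
  by exists 'X^i; rewrite addn0 hom2_Xn mulr0 add0r mulr1.
have [Q1 Q1h [c1 E1]] := IHk i.+1 j; have [Q2 Q2h [c2 E2]] := IHk i j.+1.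
rewrite addnS; rewrite !addSn /= in Q1h E1; rewrite addnS addSn /= in Q2h E2.
exists ('x ^+ i * 'y ^+ j * 'z ^+ k - Q1 - Q2).
  rewrite !rpredB //.
  exact: dhomogM (dhomogM (dhomogXiE _ _) (dhomogXiE _ _)) (dhomogXiE _ _).
exists (- c1 - c2).
rewrite linearB linearN /=.
have -> : 'x ^+ i * 'y ^+ j * 'z ^+ k.+1 = linform K * ('x ^+ i * 'y ^+ j * 'z ^+ k)
   - 'x ^+ i.+1 * 'y ^+ j * 'z ^+ k - 'x ^+ i * 'y ^+ j.+1 * 'z ^+ k :> {mpoly K[3]}.
  by rewrite /linform !exprS; ring.
by rewrite E1 E2; ring.
Qed.

(** Consequently a form is a multiple of l exactly when its dehomogenization vanishes. *)
Lemma dhomog_mod_linform e F : F \is e.-homog ->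
  exists2 Q, Q \is (e.-1).-homog & F = linform K * Q + hom2 K e (dehom K F).
Proof.
move=> Fh.
suff [Q Qh [c FE]] : exists2 Q : {mpoly K[3]}, Q \is (e.-1).-homog &
    exists c, F = linform K * Q + hom2 K e c.
  exists Q => //.
  by rewrite {2}FE rmorphD rmorphM /= dehom_linform mul0r add0r hom2_dehom_hom2.
rewrite [F]mpolyE big_seq; move/dhomogP: Fh => Fh.
elim/big_ind: _ => [|F1 F2 [Q1 Q1h [c1 ->]] [Q2 Q2h [c2 ->]]|m /Fh mE].
- by exists 0; [exact: rpred0|exists 0; rewrite mulr0 linear0 addr0].
- by exists (Q1 + Q2); [rewrite rpredD|exists (c1 + c2); rewrite linearD /=; ring].
have o0 : ord0 = @Ordinal 3 0 isT by exact: val_inj.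
have o1 : lift ord0 ord0 = @Ordinal 3 1 isT by exact: val_inj.
have o2 : lift ord0 (lift ord0 ord0) = @Ordinal 3 2 isT by exact: val_inj.
have [Q Qh [c XE]] := dhomog_mod_linform_mnm (m (@Ordinal 3 0 isT))
  (m (@Ordinal 3 1 isT)) (m (@Ordinal 3 2 isT)).
have eE : e = (m (@Ordinal 3 0 isT) + m (@Ordinal 3 1 isT) + m (@Ordinal 3 2 isT))%N.
  by rewrite -[e](mE : mdeg m = e) mdegE !big_ord_recl big_ord0 addn0 addnA o2 o1 o0.
rewrite -eE in Qh XE; exists (F@_m *: Q); first exact: rpredZ.
exists (F@_m *: c); rewrite linearZ /= -scalerAr -scalerDr -XE; congr (_ *: _).
by rewrite mpolyXE_id !big_ord_recl big_ord0 mulr1 mulrA o2 o1 o0.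
Qed.

Lemma size_dehom e F : F \is e.-homog -> (size (dehom K F) <= e.+1)%N.
Proof.
move=> Fh; have [Q _ /(congr1 (dehom K))] := dhomog_mod_linform e F Fh.
by rewrite rmorphD rmorphM /= dehom_linform mul0r add0r dehom_hom2 => ->;
  exact: size_poly.
Qed.

(** Lets a relation among homogeneous generators with arbitrary coefficients be cut down to a single
    degree. *)
Lemma pihomogMr (k e : nat) (C G : {mpoly K[3]}) : G \is e.-homog ->
  pihomog mdeg k (C * G) = (if (e <= k)%N then pihomog mdeg (k - e) C else 0) * G.
Proof.
move=> Gh; rewrite {1}[C]mpolyE mulr_suml linear_sum /=.
under eq_bigr => m _ do rewrite -scalerAl linearZ /=.
have XGh m : 'X_[m] * G \is (mdeg m + e).-homog by rewrite dhomogM ?dhomogX.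
case: leqP => [le_ek|lt_ke]; last first.
  rewrite mul0r big1 // => m _; rewrite (pihomog_ne0 _ (XGh m)) ?scaler0 //; lia.
rewrite pihomogE mulr_suml [RHS]big_mkcond; apply: eq_bigr => m _.
case: eqP => [mE|/eqP neq_m].
  by rewrite -scalerAl pihomog_dE // -(subnK le_ek) -mE.
rewrite (pihomog_ne0 _ (XGh m)) ?scaler0 //.
by apply: contraNneq neq_m => <-; rewrite addnK.
Qed.

Lemma dehom_coef_bound (k e : nat) (C : {mpoly K[3]}) :
  let C' := if (e <= k)%N then pihomog mdeg (k - e) C else 0 in
  (size (dehom K C') <= k.+1 - e)%N /\
  (dehom K C' = 0 -> exists Q, C' = linform K * Q).
Proof.
move=> C'; rewrite /C'; case: (leqP e k) => [le_ek|lt_ke]; last first.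
  by rewrite rmorph0 size_poly0; split=> // _; exists 0; rewrite mulr0.
have Ch := pihomogP mdeg (k - e) C.
split=> [|C0]; first by rewrite subSn // size_dehom.
by have [Q _ ->] := dhomog_mod_linform _ _ Ch; exists Q; rewrite C0 linear0 addr0.
Qed.

End Dehomogenization.

(** * Multiplication by l on R/I *)

(* The generators of I for alpha = a, beta = b and t = a + b + n. *)
Definition aci_gens (K : fieldType) (a b n : nat) : seq {mpoly K[3]} :=
  [:: 'x ^+ (a + (a + b + n)); 'y ^+ (b + (a + b + n));
      'z ^+ (2 * (a + b) + (a + b + n));
      'x ^+ a * 'y ^+ b * 'z ^+ (2 * (a + b))].

Section AlmostCompleteIntersection.
Variables (K : fieldType) (a b n : nat).
Local Notation I := (aci_gens K a b n).
Hypothesis natK : forall k, (0 < k < (a + b).*2 + n)%N -> k%:R != 0 :> K.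

Lemma in_aci_idealP (F : {mpoly K[3]}) :
  in_ideal I F <-> exists A B C D : {mpoly K[3]},
    F = A * 'x ^+ (a + (a + b + n)) + B * 'y ^+ (b + (a + b + n)) +
        C * 'z ^+ (2 * (a + b) + (a + b + n)) +
        D * ('x ^+ a * 'y ^+ b * 'z ^+ (2 * (a + b))).
Proof.
split=> [[c ->]|[A [B [C [D ->]]]]].
  exists (c 0), (c 1), (c 2), (c 3).
  by rewrite !big_ord_recl big_ord0 /= addr0 !addrA.
exists (nth 0 [:: A; B; C; D]).
by rewrite !big_ord_recl big_ord0 /= addr0 !addrA.
Qed.

Lemma aci_inj (d : nat) (F : {mpoly K[3]}) :
    (d.+1 < 3 * (a + b) + n)%N -> F \is d.-homog ->
  in_ideal I (linform K * F) -> in_ideal I F.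
Proof.
move=> lt_d Fh /in_aci_idealP[A [B [C [D FE]]]]; apply/in_aci_idealP.
have lFh : linform K * F \is d.+1.-homog.
  exact: (dhomogM (dhomog_linform K) Fh).
have gDh : ('x ^+ a * 'y ^+ b * 'z ^+ (2 * (a + b)) : {mpoly K[3]}) \is
    (a + b + 2 * (a + b)).-homog.
  exact: dhomogM (dhomogM (dhomogXiE _ _ _) (dhomogXiE _ _ _)) (dhomogXiE _ _ _).
have := congr1 (pihomog mdeg d.+1) FE; rewrite pihomog_dE // !linearD /=.
rewrite !(pihomogMr _ _ _ _ _ (dhomogXiE K _ _)) (pihomogMr _ _ _ _ _ gDh).
(* The generator z^(2s+t) has degree 3s + n, above d + 1. *)
rewrite [X in _ + X * 'z ^+ _]ifF ?mul0r ?addr0; last by lia.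
have [szA divA] := dehom_coef_bound K d.+1 (a + (a + b + n)) A.
have [szB divB] := dehom_coef_bound K d.+1 (b + (a + b + n)) B.
have [szD divD] := dehom_coef_bound K d.+1 (a + b + 2 * (a + b)) D.
move: (if _ then _ else _) (if _ then _ else _) (if _ then _ else _)
  szA divA szB divB szD divD => D' B' A' szA divA szB divB szD divD FE'.
have := congr1 (dehom K) FE'.
rewrite !rmorphD !rmorphM /= dehom_linform mul0r !rmorphXn /= !dehomX /=.
rewrite !expr1n !mulr1 => /esym sys0.
have [] := square_system_inj K a b n (dehom K A') (dehom K B') (dehom K D') natK.
- by apply: leq_trans szA _; lia.
- by apply: leq_trans szB _; lia.
- by apply: leq_trans szD _; lia.
- by rewrite -[RHS]sys0 /square_system; ring.
move=> /divA[QA AE] /divB[QB BE] /divD[QD DE].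
(* Each remaining coefficient is l times one of these, and l cancels from the relation. *)
exists QA, QB, 0, QD; apply: (mulfI (linform_neq0 K)).
by rewrite FE' AE BE DE; ring.
Qed.

Lemma aci_surj_hom2 (d : nat) (c : {poly K}) : (0 < a)%N -> (0 < b)%N ->
    (3 * (a + b) + n <= d.+2)%N ->
  exists2 Q, Q \is d.-homog & in_ideal I (hom2 K d.+1 c - linform K * Q).
Proof.
(* Here k is the excess of the degree d + 1 over d0 = 3s + n - 1. The system is solved for k = 0;
   higher degrees follow by [hom2S]. *)
move=> a_gt0 b_gt0 /subnK; move: (_ - _)%N => k; elim: k d c => [|k IHk] d c dE.
  have [|A [B [C [szA szB szC]]]] :=
      square_system_surj K a b n (dehom K (hom2 K d.+1 c)) natK.
    by rewrite dehom_hom2 (leq_trans (size_poly _ _)) // -dE; lia.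
  move=> cE.
  pose F : {mpoly K[3]} := hom2 K (a + b.*2).-1 A * 'x ^+ (a + (a + b + n)) +
    hom2 K (a.*2 + b).-1 B * 'y ^+ (b + (a + b + n)) +
    hom2 K n.-1 C * ('x ^+ a * 'y ^+ b * 'z ^+ (2 * (a + b))).
  have Fh : F \is d.+1.-homog.
    rewrite /F !rpredD //.
    - have -> : d.+1 = ((a + b.*2).-1 + (a + (a + b + n)))%N by lia.
      by rewrite dhomogM ?dhomog_hom2 ?dhomogXiE.
    - have -> : d.+1 = ((a.*2 + b).-1 + (b + (a + b + n)))%N by lia.
      by rewrite dhomogM ?dhomog_hom2 ?dhomogXiE.
    (* For n = 0 the truncated [n.-1] gives the wrong degree, but then C = 0. *)
    have [n0|n_gt0] := posnP n.
      move: szC; rewrite {1}n0 leqn0 size_poly_eq0 => /eqP ->.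
      by rewrite linear0 mul0r rpred0.
    have -> : d.+1 = (n.-1 + (a + b + 2 * (a + b)))%N by lia.
    by rewrite !dhomogM ?dhomog_hom2 ?dhomogXiE.
  have FE : dehom K F = dehom K (hom2 K d.+1 c).
    rewrite cE /F !rmorphD !rmorphM /= !dehom_hom2_id // !rmorphXn /= !dehomX /=.
    by rewrite !expr1n !mulr1 /square_system; ring.
  have [Q Qh FQ] := dhomog_mod_linform _ _ _ Fh.
  (* F lies in I and agrees with the given form modulo l; Q is the quotient of their difference by
     l. *)
  exists (- Q); first by rewrite rpredN.
  rewrite FE hom2_dehom_hom2 in FQ.
  have -> : hom2 K d.+1 c - linform K * - Q = F by rewrite FQ; ring.
  apply/in_aci_idealP; exists (hom2 K (a + b.*2).-1 A),
    (hom2 K (a.*2 + b).-1 B), 0, (hom2 K n.-1 C).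
  by rewrite /F; ring.
case: d dE => [|d] dE; first by lia.
have [|Q0 Q0h I0] := IHk d (c`_0)%:P; first by lia.
have [|Q1 Q1h I1] := IHk d (\poly_(j < d.+2) c`_j.+1); first by lia.
exists ('y * Q0 + 'x * Q1).
  by rewrite rpredD // -[d.+1]add1n dhomogM ?dhomogXi.
have -> : hom2 K d.+2 c - linform K * ('y * Q0 + 'x * Q1) =
    'y * (hom2 K d.+1 (c`_0)%:P - linform K * Q0) -
    - 'x * (hom2 K d.+1 (\poly_(j < d.+2) c`_j.+1) - linform K * Q1).
  by rewrite hom2S; ring.
by apply: in_idealB; apply: in_idealM.
Qed.

Lemma aci_surj (d : nat) (F : {mpoly K[3]}) : (0 < a)%N -> (0 < b)%N ->
    (3 * (a + b) + n <= d.+2)%N -> F \is d.+1.-homog ->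
  exists2 Q, Q \is d.-homog & in_ideal I (F - linform K * Q).
Proof.
move=> a_gt0 b_gt0 le_d /dhomog_mod_linform[Q Qh ->].
have [Q' Qh' IQ'] := aci_surj_hom2 d (dehom K F) a_gt0 b_gt0 le_d.
exists (Q + Q'); first exact: rpredD.
by rewrite mulrDr opprD addrACA subrr add0r.
Qed.

End AlmostCompleteIntersection.

(** * The characteristic hypothesis and the conclusion *)

Lemma natr_neq0_of_pchar (K : fieldType) (N : nat) :
    ([pchar K] =i pred0 \/ exists2 p : nat, p \in [pchar K] & (N <= p)%N) ->
  forall k, (0 < k < N)%N -> k%:R != 0 :> K.
Proof.
move=> [K0|[p pK le_Np]] k /andP[k_gt0 lt_kN].
  by rewrite (pcharf0P K).1 // -lt0n.
by rewrite -(dvdn_pcharf pK) gtnNdvd // (leq_trans lt_kN).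
Qed.

Theorem corollary4p4 (K : fieldType) (alpha beta gamma t : nat)
    (alpha_ge1 : (1 <= alpha)%N) (le_alpha_beta : (alpha <= beta)%N)
    (def_gamma : gamma = (2 * (alpha + beta))%N)
    (t_ge : (alpha + beta + gamma <= 3 * t)%N)
    (charK : [pchar K] =i pred0 \/
             exists2 p : nat, p \in [pchar K] & (t + alpha + beta <= p)%N) :
  let x : {mpoly K[3]} := 'X_(@Ordinal 3 0 isT) in
  let y : {mpoly K[3]} := 'X_(@Ordinal 3 1 isT) in
  let z : {mpoly K[3]} := 'X_(@Ordinal 3 2 isT) in
  let I : seq {mpoly K[3]} :=
    [:: x ^+ (alpha + t); y ^+ (beta + t); z ^+ (gamma + t);
        x ^+ alpha * y ^+ beta * z ^+ gamma] in
  weak_lefschetz (quot_piece I).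
Proof.
move=> x y z I; subst gamma.
have [n tE] : exists n, t = (alpha + beta + n)%N.
  by exists (t - (alpha + beta))%N; lia.
have natK : forall k, (0 < k < (alpha + beta).*2 + n)%N -> k%:R != 0 :> K.
  move=> k k_lt; apply: (natr_neq0_of_pchar _ _ charK); rewrite tE; lia.
have IE : I = aci_gens K alpha beta n by rewrite /I tE.
have beta_gt0 : (0 < beta)%N by exact: leq_trans le_alpha_beta.
rewrite IE; set J := aci_gens _ _ _ _.
exists (quot_map J (linform K)); first by exists (linform K); rewrite ?dhomog_linform.
(* The case split is whether the target degree d + 1 is at most d0. *)
move=> d; have [lt_d|le_d] := ltnP d.+1 (3 * (alpha + beta) + n).
  left=> _ _ [f fh ->] [g gh ->]; rewrite -!rmorphM => /quot_map_eq.
  rewrite -mulrBr => lfg; apply/quot_map_eq.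
  by apply: aci_inj lt_d _ lfg; rewrite // rpredB.
right=> _ [f fh ->].
have [|Q Qh fQ] := aci_surj K alpha beta n natK d f alpha_ge1 beta_gt0 _ fh.
  exact: leqW.
exists (quot_map J Q); first by exists Q.
by rewrite -rmorphM; apply/esym/quot_map_eq.
Qed.
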